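(* Let $\mathcal{X}$ be a real or complex linear space and let $q \in [1,\infty)$. Then every norm (in the usual sense) $\|\cdot\| : \mathcal{X} \to [0,\infty)$ on $\mathcal{X}$ is a $q$-norm on $\mathcal{X}$.
   Context: Definition. Let $\mathcal{X}$ be a real or complex linear space and $q \in [1,\infty)$. A mapping $\|\cdot\| : \mathcal{X} \to [0,\infty)$ is called a $q$-norm on $\mathcal{X}$ if it satisfies the following conditions: (1) $\|x\| = 0 \Leftrightarrow x = 0$; (2) $\|\lambda x\| = |\lambda|\,\|x\|$ for all $x \in \mathcal{X}$ and all scalars $\lambda$; (3) $\|x+y\|^{q} \leq 2^{q-1}\left(\|x\|^{q} + \|y\|^{q}\right)$ for all $x, y \in \mathcal{X}$. A norm in the usual sense is a mapping $\|\cdot\| : \mathcal{X} \to [0,\infty)$ satisfying (1), (2) and the triangle inequality $\|x+y\| \leq \|x\| + \|y\|$ for all $x,y \in \mathcal{X}$. *)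

(* Defs.v *)
From HB Require Import structures.
From mathcomp Require Import all_boot all_order all_algebra.
From mathcomp Require Import complex.
From mathcomp Require Import all_classical all_reals all_analysis.

Set Implicit Arguments.
Unset Strict Implicit.
Unset Printing Implicit Defensive.

Import Order.TTheory GRing.Theory Num.Theory.
Local Open Scope ring_scope.

(* The norms below take values in the real field R, whereas for K = R[i] the
   library's `|a| lies in R[i]. The R-valued absolute value on the scalar
   field is therefore a parameter abs : K -> R. It is meant to be Num.norm
   for K = R and the complex modulus Normc.normc for K = R[i].
   The first field of each record expresses that N takes values in [0, oo[. *)
Record is_norm (R : realType) (K : fieldType) (abs : K -> R)
    (X : lmodType K) (N : X -> R) : Prop := IsNorm {
  is_norm_ge0 : forall x, 0 <= N x ;
  is_norm_eq0 : forall x, N x = 0 <-> x = 0 ;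
  is_normZ : forall (a : K) (x : X), N (a *: x) = abs a * N x ;
  is_normD : forall x y, N (x + y) <= N x + N y
}.

Record is_qnorm (R : realType) (K : fieldType) (abs : K -> R)
    (X : lmodType K) (q : R) (N : X -> R) : Prop := IsQNorm {
  is_qnorm_ge0 : forall x, 0 <= N x ;
  is_qnorm_eq0 : forall x, N x = 0 <-> x = 0 ;
  is_qnormZ : forall (a : K) (x : X), N (a *: x) = abs a * N x ;
  is_qnormD : forall x y,
    N (x + y) `^ q <= 2 `^ (q - 1) * (N x `^ q + N y `^ q)
}.

(* Main.v *)
Require Import Defs.
From mathcomp Require Import all_boot all_order all_algebra.
From mathcomp Require Import complex.
From mathcomp Require Import all_classical all_reals all_analysis.
From mathcomp Require Import ring lra.

Import Order.TTheory GRing.Theory Num.Theory.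

Local Open Scope ring_scope.

(** The only condition on a q-norm that differs from those on a norm is the
    q-triangle inequality.  By the triangle inequality and the monotonicity of
    t |-> t `^ q, it reduces to the scalar inequality [powR_midpoint], the
    midpoint convexity of t |-> t `^ q cleared of its factor 2 `^ q.  The
    homogeneity condition is carried over unchanged, so the argument is
    uniform in the scalar field and in its absolute value
    ([is_norm_is_qnorm]). *)

(** Convexity of t |-> t `^ q at weight 1/2, applied to 2a and 2b, whose
    midpoint is a + b; the factor 2 `^ q / 2 is then 2 `^ (q - 1). *)
Lemma powR_midpoint (R : realType) (q a b : R) : 1 <= q -> 0 <= a -> 0 <= b ->
  (a + b) `^ q <= 2 `^ (q - 1) * (a `^ q + b `^ q).
Proof.
move=> q1 a0 b0.
have h0 : (0 : R) <= 2^-1 by lra.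
have h1 : (2^-1 : R) <= 1 by lra.
have := convex_powR q1 (Itv01 h0 h1) (x := 2 * a) (y := 2 * b).
rewrite !inE/= !in_itv/= !andbT !mulr_ge0// => /(_ isT isT).
rewrite convRE [X in X `^ _ <= _ -> _]convRE /= /unstable.onem.
have -> : 2^-1 * (2 * a) + (1 - 2^-1) * (2 * b) = a + b by field.
rewrite !powRM// => /le_trans; apply.
rewrite powRB ?pnatr_eq0 ?implybT// powRr1//.
by rewrite le_eqVlt; apply/orP; left; apply/eqP; field.
Qed.

Lemma is_norm_is_qnorm (R : realType) (K : fieldType) (abs : K -> R)
    (X : lmodType K) (q : R) (N : X -> R) :
  1 <= q -> is_norm abs N -> is_qnorm abs q N.
Proof.
move=> q1 [N0 Neq0 NZ ND]; split=> // x y.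
apply: le_trans (powR_midpoint _ _ _ _ q1 (N0 x) (N0 y)).
by rewrite ge0_ler_powR ?nnegrE ?addr_ge0// (le_trans ler01).
Qed.

Theorem proposition1p2 (R : realType) (q : R) (hq : 1 <= q) :
  (forall (X : lmodType R) (N : X -> R),
      is_norm (fun a : R => `|a|) N -> is_qnorm (fun a : R => `|a|) q N)
  /\
  (forall (X : lmodType (complex R)) (N : X -> R),
      is_norm (@Normc.normc R) N -> is_qnorm (@Normc.normc R) q N).
Proof. by split=> X N; apply: is_norm_is_qnorm. Qed.
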